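(* Let the battery capacity be infinite ($L=\infty$) and $\delta,\lambda>0$. (i) For every ergodic power policy $p$ (with stationary distribution $\pi$ as in the context) and every mismatch factor policy $\kappa:[0,\infty)\to(0,\infty)$ with $\mathbb{E}_\pi[1/\kappa(Z)]=1$, $$\mathbb{E}_{\pi}\!\left[D^{\dagger}\!\left(p(Z),\frac{1}{\kappa(Z)}\right)\right]\ \ge\ D^{\dagger}\!\left(\frac{\delta}{\lambda},1\right).$$ (ii) If there is no leakage ($\ell\equiv 0$), this bound is asymptotically achieved by a constant power and a constant mismatch factor: for $\epsilon>0$ let $p^{\star}(z)=\frac{\delta}{\lambda}+\epsilon$ for $z>0$, $p^{\star}(0)=0$, and $\kappa^{\star}(z)=1$ for $z\ge0$. Then the stationary distribution $\pi$ under $p^\star$ has atom $\pi_0$ with $1-\pi_0=\frac{\delta/\lambda}{\delta/\lambda+\epsilon}$, $$\mathbb{E}_{\pi}\!\left[D^{\dagger}\!\left(p^{\star}(Z),\frac{1}{\kappa^{\star}(Z)}\right)\right]=(1-\pi_0)\,D^{\dagger}\!\left(\frac{\delta}{\lambda}+\epsilon,1\right)+\pi_0 D_{\max},$$ and this quantity converges to $D^{\dagger}(\delta/\lambda,1)$ as $\epsilon\downarrow0$.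
   Context: Rate-distortion function: $R_s$ is a real-valued non-negative function of $D$, with thresholds $0<D_{\max}<\infty$ and $R_s^{\rm th}\in(0,\infty]$, such that [S1] $R_s(D)=0$ for $D\ge D_{\max}$; [S2] on $0<D<D_{\max}$, $R_s$ is twice continuously differentiable with $R_s'(D)<0$ and $R_s''(D)>0$, and $R_s$ is continuous at $D_{\max}$; [S3] $\lim_{D\downarrow 0}R_s'(D)=-\infty$, and $R_s'$ is finite on $(0,D_{\max})$; [S4] $\lim_{D\downarrow 0}R_s(D)=R_s^{\rm th}$, and if $R_s^{\rm th}<\infty$ then $R_s$ is right-continuous at $0$ (with $R_s(0)=R_s^{\rm th}$). Channel coding rate: $R_c:[0,\infty)\to[0,\infty)$ satisfies [C1] $R_c(p)>0$ for $p>0$, $R_c(0)=0$, and $R_c$ is right-continuous at $0$; [C2] on $p>0$, $R_c$ is twice continuously differentiable with $R_c'(p)>0$ and $R_c''(p)<0$. Distortion function: for $p\ge 0$ and $\kappa>0$, if $\kappa R_c(p)<R_s^{\rm th}$ then $D(p,\kappa)$ is the unique $D\in(0,D_{\max}]$ with $R_s(D)=\kappa R_c(p)$; if $R_s^{\rm th}<\infty$ and $\kappa R_c(p)\ge R_s^{\rm th}$ then $D(p,\kappa)=0$. Put $D^{\dagger}(p,q):=q\,D(p,1/q)$ for $p\ge0$, $q>0$, so $D^\dagger(p,1/\kappa)=D(p,\kappa)/\kappa$. Battery (infinite capacity): energy packets that are i.i.d. exponential with parameter $\lambda$ arrive at the times of a Poisson process of rate $\delta$; at charge $z$ the battery is depleted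 at rate $p(z)+\ell(z)$. The policy $p$ and leakage $\ell\ge0$ are measurable functions on $[0,\infty)$ with $p(z)>0$ for $z>0$, $p(0)=0$, $\ell(0)=0$, and both bounded. The policy $p$ is called ergodic if the charge process has a stationary distribution $\pi$: a probability measure on $[0,\infty)$ with an atom $\pi_0\ge0$ at $0$ and a density $f\ge0$ on $(0,\infty)$, so $\pi_0+\int_{0^+}^\infty f(z)\,dz=1$, satisfying the balance equation $$f(z)\bigl(p(z)+\ell(z)\bigr)=\delta e^{-\lambda z}\Bigl(\pi_0+\int_{0^+}^z e^{\lambda u}f(u)\,du\Bigr),\qquad z>0.$$ $\mathbb{E}_\pi[\phi(Z)]=\pi_0\phi(0)+\int_{0^+}^\infty\phi(z)f(z)\,dz$. The function $\kappa$ is measurable. *)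

(* Defs.v *)
From HB Require Import structures.
From mathcomp Require Import all_boot all_order all_algebra.
From mathcomp Require Import all_classical all_reals all_analysis.
Set Implicit Arguments.
Unset Strict Implicit.
Unset Printing Implicit Defensive.
Import Order.TTheory GRing.Theory Num.Theory.
Import numFieldNormedType.Exports.
Local Open Scope ring_scope.
Local Open Scope classical_set_scope.

(* [Rs] is only constrained at arguments D > 0, and at D = 0 when Rth is
   finite; elsewhere its values are never used. Finiteness of Rs' on
   (0, Dmax) is part of [rd_derivable]. *)
Record rate_distortion (R : realType) (Rs : R -> R) (Dmax : R) (Rth : \bar R)
    : Prop := RateDistortion {
  rd_Dmax_gt0 : 0 < Dmax ;
  rd_Rth_gt0 : (0 < Rth)%E ;
  rd_ge0 : forall D : R, 0 < D -> 0 <= Rs D ;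
  rd_eq0 : forall D : R, Dmax <= D -> Rs D = 0 ;
  rd_derivable : forall D : R, 0 < D < Dmax -> derivable Rs D 1 ;
  rd_derivable2 : forall D : R, 0 < D < Dmax -> derivable (Rs^`()) D 1 ;
  rd_continuous2 : forall D : R, 0 < D < Dmax -> {for D, continuous (Rs^`(2))} ;
  rd_derive_lt0 : forall D : R, 0 < D < Dmax -> Rs^`() D < 0 ;
  rd_derive2_gt0 : forall D : R, 0 < D < Dmax -> 0 < Rs^`(2) D ;
  rd_continuous_Dmax : {for Dmax, continuous Rs} ;
  rd_derive_cvg : Rs^`() D @[D --> 0^'+] --> -oo ;
  rd_cvg : (Rs D)%:E @[D --> 0^'+] --> Rth ;
  rd_at0 : (Rth < +oo)%E -> (Rs 0)%:E = Rth ;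
  rd_right_continuous0 : (Rth < +oo)%E -> Rs D @[D --> 0^'+] --> Rs 0
}.

Record coding_rate (R : realType) (Rc : R -> R) : Prop := CodingRate {
  cr_gt0 : forall p : R, 0 < p -> 0 < Rc p ;
  cr_at0 : Rc 0 = 0 ;
  cr_right_continuous0 : Rc p @[p --> 0^'+] --> Rc 0 ;
  cr_derivable : forall p : R, 0 < p -> derivable Rc p 1 ;
  cr_derivable2 : forall p : R, 0 < p -> derivable (Rc^`()) p 1 ;
  cr_continuous2 : forall p : R, 0 < p -> {for p, continuous (Rc^`(2))} ;
  cr_derive_gt0 : forall p : R, 0 < p -> 0 < Rc^`() p ;
  cr_derive2_lt0 : forall p : R, 0 < p -> Rc^`(2) p < 0
}.

(* [xget] selects an element of the set of solutions, which is a singleton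
   under [rate_distortion] and [coding_rate] (p >= 0, k > 0); the default 0
   is then never taken. *)
Definition distortion (R : realType) (Rs : R -> R) (Dmax : R) (Rth : \bar R)
    (Rc : R -> R) (p k : R) : R :=
  if ((k * Rc p)%:E < Rth)%E
  then xget 0 [set D | 0 < D <= Dmax /\ Rs D = k * Rc p]
  else 0.

Definition distortion_dagger (R : realType) (Rs : R -> R) (Dmax : R)
    (Rth : \bar R) (Rc : R -> R) (p q : R) : R :=
  q * distortion Rs Dmax Rth Rc p q^-1.

(* Functions of the charge are total on R; only their values on [0, +oo[
   matter. *)
Record power_policy (R : realType) (p : R -> R) : Prop := PowerPolicy {
  pp_measurable : measurable_fun (`[0, +oo[ : set R) p ;
  pp_gt0 : forall z : R, 0 < z -> 0 < p z ;
  pp_at0 : p 0 = 0 ;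
  pp_bounded : exists M : R, forall z : R, 0 <= z -> p z <= M
}.

Record leakage (R : realType) (l : R -> R) : Prop := Leakage {
  lk_measurable : measurable_fun (`[0, +oo[ : set R) l ;
  lk_ge0 : forall z : R, 0 <= z -> 0 <= l z ;
  lk_at0 : l 0 = 0 ;
  lk_bounded : exists M : R, forall z : R, 0 <= z -> l z <= M
}.

Record mismatch_policy (R : realType) (k : R -> R) : Prop := MismatchPolicy {
  mp_measurable : measurable_fun (`[0, +oo[ : set R) k ;
  mp_gt0 : forall z : R, 0 <= z -> 0 < k z
}.

(* A distribution on [0, +oo[ with an atom at 0 and a density on ]0, +oo[ is
   represented by the pair of the mass [pi0] of the atom and the density [f].
   Integrals are extended-real valued, so that no integrability has to be
   presupposed: all the integrands below are nonnegative. *)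
Record stationary_distribution (R : realType) (delta lambda : R)
    (p l : R -> R) (pi0 : R) (f : R -> R) : Prop := StationaryDistribution {
  sd_atom_ge0 : 0 <= pi0 ;
  sd_measurable : measurable_fun (`]0, +oo[ : set R) f ;
  sd_ge0 : forall z : R, 0 < z -> 0 <= f z ;
  sd_mass1 : (pi0%:E + \int[lebesgue_measure]_(z in `]0%R, +oo[) (f z)%:E
              = 1)%E ;
  sd_balance : forall z : R, 0 < z ->
    ((f z * (p z + l z))%:E =
     (delta * expR (- (lambda * z)))%:E *
     (pi0%:E +
      \int[lebesgue_measure]_(u in `]0%R, z]) (expR (lambda * u) * f u)%:E))%E
}.

Definition ergodic (R : realType) (delta lambda : R) (p l : R -> R) : Prop :=
  exists (pi0 : R) (f : R -> R),
    stationary_distribution delta lambda p l pi0 f.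

Definition expectation_pi (R : realType) (pi0 : R) (f : R -> R)
    (phi : R -> R) : \bar R :=
  (pi0%:E * (phi 0%R)%:E +
   \int[lebesgue_measure]_(z in `]0%R, +oo[) (phi z * f z)%:E)%E.

(* The constant power c, on whenever the battery is not empty. *)
Definition constant_power (R : realType) (c : R) (z : R) : R :=
  if 0 < z then c else 0.

(* Main.v *)
Require Import Defs.
From HB Require Import structures.
From mathcomp Require Import all_boot all_order all_algebra.
From mathcomp Require Import all_classical all_reals all_analysis.
From mathcomp Require Import measurable_realfun lra ring.
Set Implicit Arguments.
Unset Strict Implicit.
Unset Printing Implicit Defensive.
Import Order.TTheory GRing.Theory Num.Theory.
Import numFieldNormedType.Exports.
Local Open Scope ring_scope.
Local Open Scope classical_set_scope.

(* Let G be the inverse of [Rs], extended by 0 beyond the threshold [Rth].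
   Tangents to the convex [Rs] give a supporting line of slope -s <= 0 to G at
   r0 = Rc mu, and the concave [Rc] lies below its tangent at mu. Since
   D^dagger(p, q) = q G(Rc(p) / q), together they give an affine minorant
     D^dagger(mu, 1) + a (p - mu) + b (q - 1) <= D^dagger(p, q)   with a <= 0.
   Integrating the balance equation over the charge and exchanging the two
   integrals gives E[p + l] = delta / lambda, whence E[p] <= delta / lambda;
   taking the expectation of the minorant at mu = delta / lambda, q = 1 / kappa
   yields the bound. Without leakage and with constant power c, the same energy
   identity reads c (1 - pi0) = delta / lambda. *)

(** The mean value theorem on the segment between [x] and [y] turns the difference quotient into a
    value of [df], which monotonicity compares with [df x]. The point [y] may be an endpoint, where
    [f] is only continuous: this reaches [Dmax] for [Rs] and 0 for [Rc]. *)
Lemma tangent_line_le (R : realType) (f df : R -> R) (a b x y : R) :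
  (forall z, z \in `]a, b[%R -> is_derive z 1 f (df z)) ->
  {in `]a, b[%R &, {homo df : u v / u <= v}} ->
  {within `[a, b], continuous f} ->
  x \in `]a, b[%R -> y \in `[a, b]%R ->
  f x + df x * (y - x) <= f y.
Proof.
move=> fdf df_homo cf xab yab; rewrite addrC -lerBrDr.
have /andP[ax xb] : a < x < b by move: xab; rewrite in_itv.
have /andP[ay yb] : a <= y <= b by move: yab; rewrite in_itv.
have [xy|yx|->] := ltgtP x y; last by rewrite !subrr mulr0.
- have dxy z : z \in `]x, y[%R -> is_derive z 1 f (df z).
    rewrite in_itv/= => /andP[xz zy]; apply: fdf.
    by rewrite in_itv/= (lt_trans ax xz) (lt_le_trans zy yb).
  have cxy : {within `[x, y], continuous f}.
    by apply: continuous_subspaceW cf; apply: subset_itv; rewrite bnd_simp // ltW.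
  have [c + ->] := MVT xy dxy cxy.
  rewrite in_itv/= => /andP[xc cy].
  rewrite ler_pM2r ?subr_gt0// df_homo ?(ltW xc)// in_itv/=.
  by rewrite (lt_trans ax xc) (lt_le_trans cy yb).
- have dyx z : z \in `]y, x[%R -> is_derive z 1 f (df z).
    rewrite in_itv/= => /andP[yz zx]; apply: fdf.
    by rewrite in_itv/= (le_lt_trans ay yz) (lt_trans zx xb).
  have cyx : {within `[y, x], continuous f}.
    by apply: continuous_subspaceW cf; apply: subset_itv; rewrite bnd_simp // ltW.
  have [c + fxy] := MVT yx dyx cyx.
  rewrite in_itv/= => /andP[yc cx].
  rewrite -lerN2 opprB fxy -mulrN opprB ler_pM2r ?subr_gt0//.
  rewrite df_homo ?(ltW cx)// in_itv/=.
  by rewrite (le_lt_trans ay yc) (lt_trans cx xb).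
Qed.

(** * Convexity of the rate-distortion function *)

Section rate_distortion.
Context {R : realType} {Rs : R -> R} {Dmax : R} {Rth : \bar R}.
Hypothesis hRs : rate_distortion Rs Dmax Rth.

Let is_derive_Rs (D : R) : 0 < D < Dmax -> is_derive D 1 Rs (Rs^`() D).
Proof. by move=> D0; rewrite derive1E; exact/derivableP/(rd_derivable hRs). Qed.

Let continuous_Rs (D : R) : 0 < D <= Dmax -> {for D, continuous Rs}.
Proof.
case/andP=> D0; rewrite le_eqVlt => /predU1P[->|DDmax].
  exact: rd_continuous_Dmax hRs.
apply/differentiable_continuous/derivable1_diffP.
by apply: (rd_derivable hRs); rewrite D0.
Qed.

Let within_continuous_Rs (d : R) : 0 < d -> {within `[d, Dmax], continuous Rs}.
Proof.
move=> d0; apply: continuous_in_subspaceT => D; rewrite inE/= in_itv/=.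
by case/andP=> dD DDmax; apply: continuous_Rs; rewrite DDmax (lt_le_trans d0 dD).
Qed.

Lemma rate_distortion_tangent (D0 D : R) : 0 < D0 < Dmax -> 0 < D <= Dmax ->
  Rs D0 + Rs^`()%classic D0 * (D - D0) <= Rs D.
Proof.
move=> /andP[D00 D0max] /andP[D_gt0 Dmx].
(* [Rs] may blow up at 0, so the closed interval starts at a positive [d] below both points. *)
pose d := Num.min D0 D / 2.
have m0 : 0 < Num.min D0 D by rewrite lt_min D00.
have dm : d < Num.min D0 D by rewrite /d; lra.
have d0 : 0 < d by rewrite /d; lra.
have sub z : z \in `]d, Dmax[%R -> 0 < z < Dmax.
  by rewrite in_itv/= => /andP[dz ->]; rewrite (lt_trans d0 dz).
apply: (@tangent_line_le _ Rs (Rs^`())%classic d Dmax).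
- by move=> z /sub; exact: is_derive_Rs.
- apply: ger0_derive1_le_oo.
  + by move=> z /sub /(rd_derivable2 hRs).
  + by move=> z /sub /(rd_derive2_gt0 hRs) /ltW.
  + move=> z; rewrite inE/= => /sub /(rd_derivable2 hRs).
    by move/derivable1_diffP/differentiable_continuous.
- exact: within_continuous_Rs.
- by rewrite in_itv/= D0max andbT; move: dm; rewrite lt_min => /andP[].
- by rewrite in_itv/= Dmx andbT ltW//; move: dm; rewrite lt_min => /andP[].
Qed.

(** The tangent at the midpoint of [D] and [Dmax] has negative slope and a nonnegative value at the
    midpoint, so it is positive at [D]. *)
Lemma rate_distortion_gt0 (D : R) : 0 < D < Dmax -> 0 < Rs D.
Proof.
move=> /andP[D0 DDmax].
have mid : 0 < (D + Dmax) / 2 < Dmax by lra.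
have hD : 0 < D <= Dmax by rewrite D0 ltW.
apply: lt_le_trans (rate_distortion_tangent mid hD).
apply: ltr_wpDl; first by apply: (rd_ge0 hRs); case/andP: mid.
by rewrite nmulr_rgt0 ?(rd_derive_lt0 hRs)//; lra.
Qed.

(** Intermediate values between a point near 0, where [Rs] exceeds [r] because it tends to [Rth],
    and [Dmax], where it vanishes. *)
Lemma rate_distortion_surj (r : R) : 0 <= r -> (r%:E < Rth)%E ->
  exists2 D, 0 < D <= Dmax & Rs D = r.
Proof.
move=> r0 rRth.
have Dmax0 := rd_Dmax_gt0 hRs.
have [d [d0 dDmax rd]] : exists d, [/\ 0 < d, d < Dmax & r < Rs d].
  have : \forall d \near 0^'+, [/\ 0 < d, d < Dmax & r < Rs d].
    near=> d; split.
    - by [].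
    - near: d; exact: nbhs_right_lt.
    - rewrite -lte_fin; near: d.
      apply: (@rd_cvg _ _ _ _ hRs [set y | (r%:E < y)%E]).
      by apply: open_nbhs_nbhs; split => //; exact: open_ereal_gt_ereal.
  by move=> /filter_ex.
have RsDmax : Rs Dmax = 0 by apply: (rd_eq0 hRs).
have [|D] := @IVT _ Rs d Dmax r (ltW dDmax) (within_continuous_Rs d0).
  by rewrite RsDmax ge_min le_max r0 (ltW rd) orbT.
rewrite in_itv/= => /andP[dD DDmax] RsD; exists D => //.
by rewrite DDmax andbT (lt_le_trans d0 dD).
Unshelve. all: by end_near. Qed.

(** The left-hand side is the value at 0 of the tangent at [D0]; the bound is the limit of the
    tangent inequality as [D] decreases to 0. It serves for rates beyond the threshold. *)
Lemma rate_distortion_threshold_tangent (D0 : R) : 0 < D0 < Dmax ->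
  ((Rs D0 - Rs^`()%classic D0 * D0)%:E <= Rth)%E.
Proof.
move=> hD0; have dRs_lt0 := rd_derive_lt0 hRs hD0.
apply/lee_subgt0Pr => e e0.
apply: (cvge_to_ge (@rd_cvg _ _ _ _ hRs)); near=> D.
have Dgt0 : 0 < D by [].
have DltDmax : D < Dmax.
  by near: D; apply: nbhs_right_lt; exact: rd_Dmax_gt0 hRs.
(* [D] is so close to 0 that the tangent drops by less than [e] between 0 and [D]. *)
have : - Rs^`()%classic D0 * D < e.
  rewrite mulrC -ltr_pdivlMr ?oppr_gt0//; near: D; apply: nbhs_right_lt.
  by rewrite divr_gt0// oppr_gt0.
have hD : 0 < D <= Dmax by rewrite Dgt0 ltW.
have := rate_distortion_tangent hD0 hD.
rewrite -EFinB lee_fin; lra.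
Unshelve. all: by end_near. Qed.

End rate_distortion.

(** * The inverse of the rate-distortion function and its supporting lines *)

Definition rate_inverse (R : realType) (Rs : R -> R) (Dmax : R) (Rth : \bar R)
    (r : R) : R :=
  if (r%:E < Rth)%E then xget 0 [set D | 0 < D <= Dmax /\ Rs D = r] else 0.

Section rate_inverse.
Context {R : realType} {Rs : R -> R} {Dmax : R} {Rth : \bar R}.
Hypothesis hRs : rate_distortion Rs Dmax Rth.
Let G := rate_inverse Rs Dmax Rth.

Lemma rate_inverseP (r : R) : 0 <= r -> (r%:E < Rth)%E ->
  0 < G r <= Dmax /\ Rs (G r) = r.
Proof.
move=> r0 rRth; rewrite /G /rate_inverse rRth.
have [D hD RsD] := rate_distortion_surj hRs r0 rRth.
apply: (xgetPex 0 (P := [set D | 0 < D <= Dmax /\ Rs D = r])).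
by exists D.
Qed.

Lemma rate_inverse_ge0 (r : R) : 0 <= r -> 0 <= G r.
Proof.
move=> r0; case: (boolP (r%:E < Rth)%E) => [rRth|/negbTE rRth].
  by have [/andP[/ltW]] := rate_inverseP r0 rRth.
by rewrite /G /rate_inverse rRth.
Qed.

Lemma rate_inverse_at0 : G 0 = Dmax.
Proof.
have [/andP[G0 GDmax] RsG] := rate_inverseP (lexx 0) (rd_Rth_gt0 hRs).
apply/eqP; move: GDmax; rewrite le_eqVlt => /predU1P[->//|GDmax].
have : 0 < Rs (G 0) by apply: (rate_distortion_gt0 hRs); rewrite G0.
by rewrite RsG ltxx.
Qed.

(** Below the threshold, the tangent to [Rs] at [G r0], of slope [m], becomes a line of slope
    [1 / m] when the axes are exchanged, hence [s = - 1 / m]. Beyond it, [G r0 = 0] is the least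
    value of [G] on nonnegative rates and [s = 0] works. *)
Lemma rate_inverse_subgradient (r0 : R) : 0 < r0 ->
  exists2 s, 0 <= s & forall r, 0 <= r -> G r0 - s * (r - r0) <= G r.
Proof.
move=> r00; case: (boolP (r0%:E < Rth)%E) => [r0Rth|/negbTE r0Rth]; last first.
  exists 0 => // r r_ge0; rewrite mul0r subr0.
  by rewrite {1}/G /rate_inverse r0Rth; exact: rate_inverse_ge0.
have [/andP[G0 GDmax] RsG] := rate_inverseP (ltW r00) r0Rth.
(* [Rs] vanishes at [Dmax], so [r0 > 0] keeps [G r0] inside the interval where [Rs] is
   differentiable. *)
have hG : 0 < G r0 < Dmax.
  rewrite G0 lt_neqAle GDmax andbT; apply/eqP => GE.
  by move: r00; rewrite -RsG GE (rd_eq0 hRs)// ltxx.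
set m := Rs^`()%classic (G r0).
have m0 : 0 < - m by rewrite oppr_gt0; exact: (rd_derive_lt0 hRs).
exists (- m)^-1; first by rewrite invr_ge0 ltW.
move=> r r_ge0; rewrite lerBlDr -lerBlDl mulrC ler_pdivlMr//.
case: (boolP (r%:E < Rth)%E) => [rRth|rRth].
  have [hr RsGr] := rate_inverseP r_ge0 rRth.
  have := rate_distortion_tangent hRs hG hr.
  by rewrite RsG RsGr -/m; lra.
(* With [G r = 0], the claim says that the tangent at [G r0] takes at 0 a value at most [r]; that
   value is at most [Rth], and [Rth] is at most [r]. *)
have -> : G r = 0 by rewrite /G /rate_inverse (negbTE rRth).
have := rate_distortion_threshold_tangent hRs hG.
move: rRth; rewrite -leNgt => rRth /le_trans /(_ rRth).
by rewrite lee_fin RsG -/m; lra.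
Qed.

End rate_inverse.

(** * Concavity of the coding rate *)

Section coding_rate.
Context {R : realType} {Rc : R -> R}.
Hypothesis hRc : coding_rate Rc.

Lemma coding_rate_ge0 (p : R) : 0 <= p -> 0 <= Rc p.
Proof.
rewrite le_eqVlt => /predU1P[<-|/(cr_gt0 hRc)/ltW//].
by rewrite (cr_at0 hRc).
Qed.

(** The convex case applied to [- Rc] on [[0, b]], with [b] past both points. Right-continuity at 0
    admits [p = 0], the power at an empty battery. *)
Lemma coding_rate_tangent (p0 p : R) : 0 < p0 -> 0 <= p ->
  Rc p <= Rc p0 + Rc^`()%classic p0 * (p - p0).
Proof.
move=> p00 p_ge0; pose b := Num.max p0 p + 1.
have pb : p < b /\ p0 < b.
  by rewrite /b; split; rewrite ltr_pwDr// le_max lexx ?orbT.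
have sub z : z \in `]0, b[%R -> 0 < z by rewrite in_itv/= => /andP[].
have contRc (z : R) : 0 < z -> {for z, continuous Rc}.
  by move=> z0; exact/differentiable_continuous/derivable1_diffP/(cr_derivable hRc).
rewrite -lerN2 opprD -mulNr.
apply: (@tangent_line_le _ (- Rc) (fun z => - Rc^`()%classic z) 0 b).
- move=> z /sub z0; apply: is_deriveN; rewrite derive1E.
  exact/derivableP/(cr_derivable hRc).
- move=> u v ub vb uv; rewrite lerN2; move: uv.
  apply: (@ler0_derive1_le_oo _ _ 0 b) => //.
  + by move=> z /sub /(cr_derivable2 hRc).
  + by move=> z /sub /(cr_derive2_lt0 hRc) /ltW.
  + move=> z; rewrite inE/= => /sub /(cr_derivable2 hRc).
    by move/derivable1_diffP/differentiable_continuous.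
- have b0 : 0 < b by case: pb => _; exact: lt_trans.
  apply/(continuous_within_itvP _ b0); split.
  + by move=> z /sub z0; apply: continuousN; exact: contRc.
  + by apply: cvgN; exact: cr_right_continuous0 hRc.
  + by apply: cvg_at_left_filter; apply: continuousN; exact: contRc.
- by rewrite in_itv/= p00; case: pb.
- by rewrite in_itv/= p_ge0 ltW//; case: pb.
Qed.

End coding_rate.

(** * Affine minorants of D^dagger *)

Section distortion_dagger.
Context {R : realType} {Rs : R -> R} {Dmax : R} {Rth : \bar R} {Rc : R -> R}.
Hypotheses (hRs : rate_distortion Rs Dmax Rth) (hRc : coding_rate Rc).
Let Ddag := distortion_dagger Rs Dmax Rth Rc.
Let G := rate_inverse Rs Dmax Rth.

(** [distortion] unfolds to [rate_inverse] at the rate [q^-1 * Rc p], so this is a conversion.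
    [Ddag] is thus the perspective of [G], composed with [Rc]. *)
Let DdagE (p q : R) : Ddag p q = q * G (q^-1 * Rc p). Proof. by []. Qed.

Let Ddag1E (p : R) : Ddag p 1 = G (Rc p).
Proof. by rewrite DdagE invr1 !mul1r. Qed.

Lemma distortion_dagger_ge0 (p q : R) : 0 <= p -> 0 <= q -> 0 <= Ddag p q.
Proof.
move=> p0 q0; rewrite DdagE mulr_ge0// (rate_inverse_ge0 hRs)// mulr_ge0 ?invr_ge0//.
exact: coding_rate_ge0 hRc _ p0.
Qed.

Lemma distortion_dagger01 : Ddag 0 1 = Dmax.
Proof. by rewrite Ddag1E (cr_at0 hRc); exact: rate_inverse_at0. Qed.

Lemma distortion_dagger_subgradient (mu : R) : 0 < mu ->
  exists a b, a <= 0 /\ forall p q, 0 <= p -> 0 < q ->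
    Ddag mu 1 + a * (p - mu) + b * (q - 1) <= Ddag p q.
Proof.
move=> mu0; have Rcmu := cr_gt0 hRc mu0.
have [s s0 hs] := rate_inverse_subgradient hRs Rcmu.
(* Multiplying the supporting line of [G] at [Rc mu] by [q] gives
   [q * (G (Rc mu) + s * Rc mu) - s * Rc p], so the coefficient of [q] is [b]. Bounding [Rc p] by
   its tangent at [mu], with [s >= 0], produces [a]. *)
exists (- (s * Rc^`()%classic mu)), (G (Rc mu) + s * Rc mu); split.
  by rewrite oppr_le0 mulr_ge0// ltW// (cr_derive_gt0 hRc).
move=> p q p0 q0; rewrite Ddag1E DdagE.
have qp : 0 <= q^-1 * Rc p by rewrite mulr_ge0 ?invr_ge0 ?(ltW q0) ?(coding_rate_ge0 hRc).
have := ler_wpM2l (ltW q0) (hs _ qp).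
have := ler_wpM2l s0 (coding_rate_tangent hRc mu0 p0).
rewrite -/G; set x := q^-1 * Rc p; have -> : Rc p = q * x by rewrite mulVKf ?gt_eqF.
lra.
Qed.

Lemma distortion_dagger_right_cvg (mu : R) : 0 < mu ->
  Ddag (mu + e) 1 @[e --> 0^'+] --> Ddag mu 1.
Proof.
move=> mu0; have [a [b [a0 hab]]] := distortion_dagger_subgradient mu0.
apply: (@squeeze_cvgr _ _ _ _ (fun e => Ddag mu 1 + a * e) (cst (Ddag mu 1))).
- near=> e; have e0 : 0 < e by [].
  have mue0 : 0 < mu + e by rewrite addr_gt0.
  apply/andP; split.
    by have := hab _ _ (ltW mue0) ltr01; rewrite subrr mulr0 addr0 addrAC subrr add0r.
  (* The minorant taken at [mu + e] and evaluated at [mu]: its slope [a'] is nonpositive, whence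
     [Ddag (mu + e) 1 <= Ddag mu 1]. *)
  have [a' [b' [a'0 hab']]] := distortion_dagger_subgradient mue0.
  have := hab' _ _ (ltW mu0) ltr01; rewrite subrr mulr0 addr0; apply: le_trans.
  by rewrite lerDl opprD addNKr mulr_le0// oppr_le0 ltW.
- apply: cvg_at_right_filter; rewrite -[X in _ --> X]addr0 -[X in _ + X](mulr0 a).
  by apply: cvgD; [exact: cvg_cst|apply: cvgM; [exact: cvg_cst|exact: cvg_id]].
- exact: cvg_cst.
Unshelve. all: by end_near. Qed.

End distortion_dagger.

(** The integral of [h] is at most that of its positive part, and integrals of nonnegative functions
    are suprema over simple functions, hence monotone. No measurability enters, which suits the cost
    [Ddag (p z) (kappa z)^-1]. *)
Lemma le_integral_ge0 d (T : measurableType d) (R : realType)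
    (mu : {measure set T -> \bar R}) (D : set T) (h g : T -> \bar R) :
  (forall x, D x -> (0 <= g x)%E) -> (forall x, D x -> (h x <= g x)%E) ->
  (\int[mu]_(x in D) h x <= \int[mu]_(x in D) g x)%E.
Proof.
move=> g0 hg; rewrite integralE.
apply: (@le_trans _ _ (\int[mu]_(x in D) h^\+ x)%E).
  by apply: geeDl; rewrite oppe_le0; apply: integral_ge0.
have hp0 x : D x -> (0 <= h^\+ x)%E by [].
rewrite !ge0_integralE//; apply: le_ereal_sup => _ [s sh <-]; exists s => //= x.
apply: le_trans (sh x) _; apply: lee_restrict => {}x Dx.
by rewrite funeposE ge_max hg// g0.
Qed.

(** * Integrals of exponentials *)

Lemma integral_expR_tail (R : realType) (lambda u : R) : 0 < lambda ->
  (\int[lebesgue_measure]_(z in `[u, +oo[) (expR (- (lambda * z)))%:E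
   = (expR (- (lambda * u)) / lambda)%:E)%E.
Proof.
move=> lambda0.
pose F (z : R) := - (lambda^-1 * expR (- (lambda * z))).
have dF (z : R) : is_derive z 1 F (expR (- (lambda * z))).
  rewrite /F; apply: is_derive_eq.
  by rewrite /GRing.scale/= mulr1 mulrN mulrN opprK [X in _ * X]mulrC mulKf ?gt_eqF.
have cexp : continuous (fun z : R => expR (- (lambda * z))).
  by move=> z; apply: continuous_comp; [apply: continuousN; apply: mulrl_continuous
    |exact: continuous_expR].
rewrite (@ge0_continuous_FTC2y _ (fun z => expR (- (lambda * z))) F u 0).
- by rewrite -EFinB sub0r opprK mulrC.
- by move=> z _; exact: expR_ge0.
- exact: continuous_subspaceT.
- rewrite -oppr0 -[X in - X](mulr0 lambda^-1); apply: cvgN.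
  apply: cvgM; first exact: cvg_cst.
  apply: (@cvg_comp _ _ _ ( *%R lambda) (fun z => expR (- z)) _ (pinfty_nbhs R));
    last exact: cvgr_expR.
  exact: gt0_cvgMry.
- by move=> z _; exact: ex_derive.
- apply: cvg_at_right_filter; apply: cvgN; apply: cvgM; first exact: cvg_cst.
  exact: cexp.
- by move=> z _; rewrite derive1E; exact: derive_val.
Qed.

Lemma integral_expR_itv (R : realType) (b z : R) : 0 < z ->
  (\int[lebesgue_measure]_(u in `]0%R, z]) (b * expR (b * u))%:E = (expR (b * z) - 1)%:E)%E.
Proof.
move=> z0.
have cexp : continuous (fun u : R => expR (b * u)).
  by move=> u; apply: continuous_comp; [exact: mulrl_continuous|exact: continuous_expR].
have cbexp : continuous (fun u : R => b * expR (b * u)).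
  by move=> u; apply: cvgM; [exact: cvg_cst|exact: cexp].
have dexp (u : R) : is_derive u 1 (fun u : R => expR (b * u)) (b * expR (b * u)).
  by apply: is_derive_eq; rewrite /GRing.scale/= mulr1 mulrC.
rewrite integral_itv_obnd_cbnd; last first.
  apply/measurable_EFinP; apply: measurable_funTS.
  exact: continuous_measurable_fun.
rewrite (@continuous_FTC2 _ _ (fun u => expR (b * u)))//.
- by rewrite mulr0 expR0 -EFinB.
- exact: continuous_subspaceT.
- split.
  + by move=> u _; exact: ex_derive.
  + by apply: cvg_at_right_filter; exact: cexp.
  + by apply: cvg_at_left_filter; exact: cexp.
- by move=> u _; rewrite derive1E; exact: derive_val.
Qed.

(** * Energy balance of a stationary distribution *)

Section stationary.
Context {R : realType} {delta lambda pi0 : R} {p l f : R -> R}.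
Hypotheses (hdelta : 0 < delta) (hlambda : 0 < lambda).
Hypothesis hsd : stationary_distribution delta lambda p l pi0 f.
Local Open Scope ereal_scope.
Local Notation mu := (@lebesgue_measure R).

Let mf : measurable_fun (`]0%R, +oo[ : set R) f := sd_measurable hsd.

Lemma stationary_integral_density :
  \int[mu]_(z in `]0%R, +oo[) (f z)%:E = (1 - pi0)%:E.
Proof.
have : \int[mu]_(z in `]0%R, +oo[) (f z)%:E = 1 - pi0%:E.
  by rewrite -(sd_mass1 hsd) addeAC subee ?add0e.
by [].
Qed.

Lemma stationary_integrable_density :
  mu.-integrable `]0%R, +oo[ (EFin \o f).
Proof.
apply/integrableP; split; first exact/measurable_EFinP.
rewrite [ltLHS](_ : _ = (1 - pi0)%:E) ?ltry// -stationary_integral_density.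
apply: eq_integral => z; rewrite inE/= in_itv/= andbT => z0.
by rewrite ger0_norm// (sd_ge0 hsd).
Qed.

(** Extended by 0 to the whole line, so that the exchange of integrals takes place on the full
    plane. *)
Let w : R -> R := (fun u => expR (lambda * u) * f u)%R \_ `]0%R, +oo[.

Let w_ge0 u : (0 <= w u)%R.
Proof.
rewrite /w; apply: restrict_ge0 => {}u/=; rewrite in_itv/= andbT => u0.
by rewrite mulr_ge0 ?expR_ge0 ?(sd_ge0 hsd).
Qed.

Let measurable_expM (a : R) : measurable_fun [set: R] (fun u : R => expR (a * u)).
Proof. by apply: measurableT_comp => //; exact: mulrl_measurable. Qed.

Let mw : measurable_fun [set: R] w.
Proof.
have : measurable_fun (`]0%R, +oo[ : set R) (fun u => expR (lambda * u) * f u)%R.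
  apply: measurable_funM => //.
  by apply: measurable_funTS; exact: measurable_expM.
by move/(measurable_restrictT _ _).1; exact.
Qed.

(** The double integrand behind the density part of the balance equation, supported on the triangle
    where [u] lies below the charge [z]. *)
Let g (zu : R * R) : R :=
  (if zu.2 <= zu.1 then delta * expR (- (lambda * zu.1)) * w zu.2 else 0)%R.

Let g_ge0 zu : 0 <= (g zu)%:E.
Proof.
rewrite lee_fin /g; case: ifP => // _.
by rewrite mulr_ge0 ?w_ge0// mulr_ge0 ?expR_ge0// ltW.
Qed.

Let mg : measurable_fun [set: R * R] (EFin \o g).
Proof.
apply/measurable_EFinP; apply: measurable_fun_ifT.
- by apply: measurable_fun_ler; [exact: measurable_snd|exact: measurable_fst].
- apply: measurable_funM; last by apply: measurableT_comp => //; exact: measurable_snd.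
  apply: measurable_funM => //.
  under eq_fun do rewrite -mulNr.
  by apply: (measurableT_comp (measurable_expM _)); exact: measurable_fst.
- exact: measurable_cst.
Qed.

Let integral_g_charge (z : R) : (0 < z)%R -> \int[mu]_u (g (z, u))%:E =
  (delta * expR (- (lambda * z)))%:E *
  \int[mu]_(u in `]0%R, z]) (expR (lambda * u) * f u)%:E.
Proof.
move=> z0; rewrite -ge0_integralZl_EFin//; first last.
- by rewrite mulr_ge0 ?expR_ge0// ltW.
- apply/measurable_EFinP; apply: measurable_funM.
    by apply: measurable_funTS; exact: measurable_expM.
  by apply: measurable_funS mf => //; apply: subset_itv.
- move=> u /=; rewrite in_itv/= => /andP[u0 _].
  by rewrite lee_fin mulr_ge0 ?expR_ge0 ?(sd_ge0 hsd).
rewrite [RHS]integral_mkcond; apply: eq_integral => u _.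
rewrite /g/= /w !patchE !mem_setE !in_itv/= andbT.
by case: (0 < u)%R; case: (u <= z)%R; rewrite ?mulr0.
Qed.

(** The exponential tail from [u] onwards cancels the factor [expR (lambda * u)] of [w]. *)
Let integral_g_arrival (u : R) : \int[mu]_z (g (z, u))%:E =
  (delta / lambda)%:E * ((f \_ `]0%R, +oo[) u)%:E.
Proof.
transitivity (\int[mu]_(z in `[u, +oo[)
    ((delta * w u)%:E * (expR (- (lambda * z)))%:E)).
  rewrite [RHS]integral_mkcond; apply: eq_integral => z _.
  rewrite /g/= !patchE mem_setE in_itv/= andbT.
  by case: ifP => // _; rewrite -EFinM mulrAC.
rewrite ge0_integralZl_EFin//; first last.
- by rewrite mulr_ge0 ?w_ge0// ltW.
- apply/measurable_EFinP; apply: measurable_funTS.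
  by under eq_fun do rewrite -mulNr; exact: measurable_expM.
rewrite integral_expR_tail// -!EFinM /w !patchE; congr EFin.
case: ifP => _; last by rewrite mulr0 mul0r mulr0.
rewrite expRN; field; rewrite gt_eqF//=.
by rewrite gt_eqF ?expR_gt0.
Qed.

(** The atom contributes [delta / lambda * pi0] and the density part [delta / lambda * (1 - pi0)],
    so the total does not depend on [pi0]. *)
Lemma stationary_energy_balance :
  \int[mu]_(z in `]0%R, +oo[) (f z * (p z + l z))%:E = (delta / lambda)%:E.
Proof.
have itv0E z : z \in (`]0%R, +oo[ : set R) = (0 < z)%R.
  by rewrite mem_setE in_itv/= andbT.
have e_ge0 z : 0 <= (delta * expR (- (lambda * z)) * pi0)%:E.
  by rewrite lee_fin !mulr_ge0 ?expR_ge0 ?(sd_atom_ge0 hsd)// ltW.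
transitivity (\int[mu]_(z in `]0%R, +oo[)
    ((delta * expR (- (lambda * z)) * pi0)%:E + \int[mu]_u (g (z, u))%:E)).
  apply: eq_integral => z; rewrite itv0E => z0.
  rewrite (sd_balance hsd)// integral_g_charge// ge0_muleDr//.
    exact: sd_atom_ge0 hsd.
  apply: integral_ge0 => u /=; rewrite in_itv/= => /andP[u0 _].
  by rewrite lee_fin mulr_ge0 ?expR_ge0 ?(sd_ge0 hsd).
have mexp : measurable_fun [set: R] (fun z => expR (- (lambda * z)))%R.
  by under eq_fun do rewrite -mulNr; exact: measurable_expM.
rewrite ge0_integralD//; first last.
- apply: measurable_funTS.
  exact: (measurable_fun_fubini_tonelli_F (m2 := mu) (EFin \o g)).
- by move=> z _; apply: integral_ge0 => u _; exact: g_ge0.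
- apply/measurable_EFinP; apply: measurable_funTS.
  by apply: measurable_funM => //; apply: measurable_funM.
have -> : \int[mu]_(z in `]0%R, +oo[) (delta * expR (- (lambda * z)) * pi0)%:E =
    (delta / lambda * pi0)%:E.
  under eq_integral do rewrite mulrAC EFinM.
  rewrite ge0_integralZl_EFin//; first last.
  - by rewrite mulr_ge0 ?(sd_atom_ge0 hsd)// ltW.
  - by apply/measurable_EFinP; exact: measurable_funTS.
  rewrite integral_itv_obnd_cbnd; last first.
    by apply/measurable_EFinP; exact: measurable_funTS.
  rewrite integral_expR_tail// mulr0 oppr0 expR0 -EFinM; congr EFin.
  by rewrite div1r mulrAC.
(* For [z <= 0], every [u <= z] lies where [w] is 0, so the outer integral extends to the whole
   line. *)
have -> : \int[mu]_(z in `]0%R, +oo[) (\int[mu]_u (g (z, u))%:E) =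
    \int[mu]_z (\int[mu]_u (g (z, u))%:E).
  rewrite integral_mkcond; apply: eq_integral => z _.
  rewrite patchE itv0E; case: ltP => // z0; apply/esym/integral0_eq => u _.
  rewrite /g/=; case: leP => // uz; rewrite /w patchE itv0E ltNge (le_trans uz z0)/=.
  by rewrite mulr0.
have -> : \int[mu]_z (\int[mu]_u (g (z, u))%:E) =
    \int[mu]_u (\int[mu]_z (g (z, u))%:E).
  exact: (fubini_tonelli (m1 := mu) (m2 := mu) (EFin \o g) mg g_ge0).
under eq_integral do rewrite integral_g_arrival.
rewrite ge0_integralZl_EFin//; first last.
- by rewrite divr_ge0// ltW.
- by apply/measurable_EFinP; move: mf => /(measurable_restrictT _ _).1; exact.
- move=> u _; rewrite lee_fin; apply: restrict_ge0 => z/=.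
  by rewrite in_itv/= andbT => /(sd_ge0 hsd).
have -> : \int[mu]_u ((f \_ `]0%R, +oo[) u)%:E = (1 - pi0)%:E.
  rewrite -stationary_integral_density [RHS]integral_mkcond.
  by apply: eq_integral => u _; rewrite restrict_EFin.
by rewrite -EFinM -EFinD; congr EFin; ring.
Qed.

End stationary.

(** * Mean power under a stationary distribution *)

Section stationary_policy.
Context {R : realType} {delta lambda pi0 : R} {p l f : R -> R}.
Hypotheses (hdelta : 0 < delta) (hlambda : 0 < lambda).
Hypotheses (hl : leakage l) (hp : power_policy p).
Hypothesis hsd : stationary_distribution delta lambda p l pi0 f.
Local Open Scope ereal_scope.
Local Notation mu := (@lebesgue_measure R).

Lemma power_policy_ge0 (z : R) : (0 <= z)%R -> (0 <= p z)%R.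
Proof.
rewrite le_eqVlt => /predU1P[<-|/(pp_gt0 hp)/ltW//].
by rewrite (pp_at0 hp).
Qed.

Let mf : measurable_fun (`]0%R, +oo[ : set R) f := sd_measurable hsd.

Let mp : measurable_fun (`]0%R, +oo[ : set R) p.
Proof.
apply: measurable_funS (pp_measurable hp) => // z.
by rewrite /= !in_itv/= !andbT; exact: ltW.
Qed.

Lemma stationary_mean_power_le :
  \int[mu]_(z in `]0%R, +oo[) (p z * f z)%:E <= (delta / lambda)%:E.
Proof.
rewrite -(stationary_energy_balance hdelta hlambda hsd).
apply: le_integral_ge0 => z; rewrite /= in_itv/= andbT => z0; rewrite lee_fin.
- by rewrite mulr_ge0 ?(sd_ge0 hsd)// addr_ge0 ?(lk_ge0 hl) ?power_policy_ge0// ltW.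
- by rewrite mulrC ler_wpM2l ?(sd_ge0 hsd)// lerDl (lk_ge0 hl)// ltW.
Qed.

(** Finiteness comes from the bound [delta / lambda] on the mean power. *)
Lemma stationary_integrable_power :
  mu.-integrable `]0%R, +oo[ (EFin \o (fun z => p z * f z)%R).
Proof.
apply/integrableP; split.
  by apply/measurable_EFinP; exact: measurable_funM.
apply: le_lt_trans (ltry (delta / lambda)); apply: le_trans stationary_mean_power_le.
rewrite le_eqVlt; apply/orP; left; apply/eqP.
apply: eq_integral => z; rewrite inE/= in_itv/= andbT => z0.
by rewrite ger0_norm// mulr_ge0 ?(sd_ge0 hsd)// power_policy_ge0// ltW.
Qed.

End stationary_policy.

(** * The density part of the constraint on the mismatch factor *)

Section mismatch.
Context {R : realType} {delta lambda pi0 : R} {p l f kappa : R -> R}.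
Hypotheses (hkappa : mismatch_policy kappa).
Hypothesis hsd : stationary_distribution delta lambda p l pi0 f.
Hypothesis hmean : expectation_pi pi0 f (fun z => (kappa z)^-1) = 1%E.
Local Open Scope ereal_scope.
Local Notation mu := (@lebesgue_measure R).

Lemma mismatch_integral :
  \int[mu]_(z in `]0%R, +oo[) ((kappa z)^-1 * f z)%:E
  = (1 - pi0 * (kappa 0)^-1)%:E.
Proof.
have : \int[mu]_(z in `]0%R, +oo[) ((kappa z)^-1 * f z)%:E =
    1 - (pi0 * (kappa 0)^-1)%:E.
  by rewrite -hmean /expectation_pi EFinM addeAC subee ?add0e.
by [].
Qed.

Lemma mismatch_integrable :
  mu.-integrable `]0%R, +oo[ (EFin \o (fun z => (kappa z)^-1 * f z)%R).
Proof.
apply/integrableP; split.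
  apply/measurable_EFinP; apply: measurable_funM; last exact: sd_measurable hsd.
  (* On positive values the inverse is the power of exponent -1, whose measurability is
     available. *)
  apply: (@eq_measurable_fun _ _ _ _ _ (fun z => powR (kappa z) (-1))).
    move=> z; rewrite inE/= in_itv/= andbT => z0.
    by rewrite powR_inv1// ltW// (mp_gt0 hkappa)// ltW.
  apply: measurableT_comp (measurable_powR _) _.
  apply: measurable_funS (mp_measurable hkappa) => // z.
  by rewrite /= !in_itv/= !andbT; exact: ltW.
rewrite [ltLHS](_ : _ = (1 - pi0 * (kappa 0)^-1)%:E) ?ltry// -mismatch_integral.
apply: eq_integral => z; rewrite inE/= in_itv/= andbT => z0.
by rewrite ger0_norm// mulr_ge0 ?(sd_ge0 hsd)// invr_ge0 ltW// (mp_gt0 hkappa)// ltW.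
Qed.

End mismatch.

Lemma expectation_dagger_ge (R : realType)
    (Rs : R -> R) (Dmax : R) (Rth : \bar R) (Rc : R -> R)
    (delta lambda : R) (p l : R -> R) (pi0 : R) (f kappa : R -> R)
    (Ddag := distortion_dagger Rs Dmax Rth Rc) :
  rate_distortion Rs Dmax Rth -> coding_rate Rc ->
  0 < delta -> 0 < lambda -> leakage l -> power_policy p ->
  stationary_distribution delta lambda p l pi0 f ->
  mismatch_policy kappa ->
  expectation_pi pi0 f (fun z => (kappa z)^-1) = 1%E ->
  ((Ddag (delta / lambda) 1)%:E <=
   expectation_pi pi0 f (fun z => Ddag (p z) (kappa z)^-1)%R)%E.
Proof.
move=> hRs hRc hdelta hlambda hl hp hsd hkappa hmean.
set mu := delta / lambda; have mu0 : 0 < mu by rewrite divr_gt0.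
have [a [b [a0 hab]]] := distortion_dagger_subgradient hRs hRc mu0.
rewrite -/Ddag in hab.
(* The constant term of the affine minorant. *)
set C := Ddag mu 1 - a * mu - b.
have q0 z : 0 <= z -> 0 < (kappa z)^-1.
  by move=> z0; rewrite invr_gt0 (mp_gt0 hkappa).
have hle z : 0 <= z -> C + a * p z + b * (kappa z)^-1 <= Ddag (p z) (kappa z)^-1.
  move=> z0; have := hab _ _ (power_policy_ge0 hp z0) (q0 _ z0).
  by apply: le_trans; rewrite /C; lra.
have If := stationary_integrable_density hsd.
have Ip := stationary_integrable_power hdelta hlambda hl hp hsd.
have Iq := mismatch_integrable hkappa hsd hmean.
have mean_le := stationary_mean_power_le hdelta hlambda hl hp hsd.
have Ep_fin : (\int[lebesgue_measure]_(z in `]0%R, +oo[) (p z * f z)%:E)%E \is a fin_num.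
  exact: integrable_fin_num Ip.
set Ep := (\int[lebesgue_measure]_(z in `]0%R, +oo[) (p z * f z)%:E)%E in mean_le Ep_fin.
have Eh : (\int[lebesgue_measure]_(z in `]0%R, +oo[)
     ((C%:E * (f z)%:E + a%:E * (p z * f z)%:E) + b%:E * ((kappa z)^-1 * f z)%:E) =
     (C * (1 - pi0) + a * fine Ep + b * (1 - pi0 * (kappa 0)^-1))%:E)%E.
  have integrable_scale k (h : R -> R) :
      lebesgue_measure.-integrable `]0%R, +oo[ (EFin \o h) ->
      lebesgue_measure.-integrable `]0%R, +oo[ (fun z => (k%:E * (h z)%:E)%E).
    by move=> ih; exact: integrableZl.
  have IC := integrable_scale C _ If.
  have Ia := integrable_scale a _ Ip.
  have Ib := integrable_scale b _ Iq.
  rewrite integralD//=; last exact: integrableD.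
  rewrite integralD//= !integralZl//= (stationary_integral_density hsd).
  by rewrite (mismatch_integral hmean) -/Ep -{1}(fineK Ep_fin).
(* The middle term is the expectation of the minorant. As the masses and the mean of [1 / kappa] are
   both 1, it equals [Ddag mu 1 + a * (fine Ep - mu)], where [a <= 0] and [fine Ep <= mu]. *)
apply: (@le_trans _ _ (pi0%:E * (C + a * p 0 + b * (kappa 0)^-1)%:E +
   (C * (1 - pi0) + a * fine Ep + b * (1 - pi0 * (kappa 0)^-1))%:E)%E).
  have fEp : fine Ep <= mu by rewrite -lee_fin fineK.
  rewrite -EFinM -EFinD lee_fin (pp_at0 hp) mulr0 addr0.
  have := ler_wnM2l a0 fEp; rewrite /C; lra.
apply: leeD.
  by rewrite -!EFinM lee_fin ler_wpM2l ?(sd_atom_ge0 hsd)// hle.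
rewrite -Eh; apply: le_integral_ge0 => z /=; rewrite in_itv/= andbT => z0.
  rewrite lee_fin mulr_ge0 ?(sd_ge0 hsd)//.
  by rewrite (distortion_dagger_ge0 hRs hRc) ?(power_policy_ge0 hp) ?ltW// q0 ?ltW.
rewrite -!EFinM -!EFinD lee_fin.
have := ler_wpM2r (sd_ge0 hsd z0) (hle _ (ltW z0)).
by apply: le_trans; rewrite !mulrDl !mulrA.
Qed.

(** * Constant power without leakage *)

Section constant_power.
Context {R : realType} {delta lambda : R} {l : R -> R} (c : R).
Hypotheses (hdelta : 0 < delta) (hlambda : 0 < lambda).
Hypothesis l0 : forall z : R, 0 <= z -> l z = 0.
Local Notation mu := (@lebesgue_measure R).

Lemma power_policy_constant_power : 0 < c -> power_policy (constant_power c).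
Proof.
move=> c0; split.
- apply: measurable_funTS; apply: measurable_fun_ifT => //.
  by apply: measurable_fun_ltr.
- by move=> z z0; rewrite /constant_power z0.
- by rewrite /constant_power ltxx.
- by exists c => z _; rewrite /constant_power; case: ifP => // _; exact: ltW.
Qed.

(** Under constant power the balance equation differentiates to [f' = (delta / c - lambda) f], so
    the density is exponential, and it decays exactly when [delta / lambda < c]. *)
Lemma ergodic_constant_power : delta / lambda < c ->
  ergodic delta lambda (constant_power c) l.
Proof.
move=> hc.
have c0 : 0 < c by apply: lt_trans hc; rewrite divr_gt0.
have b0 : 0 < lambda - delta / c.
  by rewrite subr_gt0 ltr_pdivrMr// mulrC -ltr_pdivrMr.
have lc0 : 0 < lambda * c - delta by rewrite subr_gt0 mulrC -ltr_pdivrMr.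
have pi0_ge0 : 0 <= 1 - delta / (lambda * c).
  by rewrite subr_ge0 ler_pdivrMr ?mulr_gt0// mul1r mulrC -ler_pdivrMr// ltW.
(* [A] is forced by the balance equation as [z] tends to 0, and [pi0] by the total mass
   [pi0 + A / b = 1]. *)
pose pi0 := 1 - delta / (lambda * c).
pose b := lambda - delta / c.
pose A := delta * pi0 / c.
have A0 : 0 <= A by rewrite divr_ge0 ?mulr_ge0// ltW.
have mexp : measurable_fun [set: R] (fun z : R => expR (- (b * z))).
  apply: continuous_measurable_fun => z.
  by apply: continuous_comp; [apply: continuousN; exact: mulrl_continuous
    |exact: continuous_expR].
exists pi0, (fun z => A * expR (- (b * z))); split.
- exact: pi0_ge0.
- by apply: measurable_funTS; exact: measurable_funM.
- by move=> z _; rewrite mulr_ge0 ?expR_ge0.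
- under eq_integral do rewrite EFinM.
  rewrite ge0_integralZl_EFin//; last first.
    by apply/measurable_EFinP; exact: measurable_funTS.
  rewrite integral_itv_obnd_cbnd; last first.
    by apply/measurable_EFinP; exact: measurable_funTS.
  rewrite integral_expR_tail// mulr0 oppr0 expR0 -EFinM -EFinD; congr EFin.
  rewrite /A /pi0 /b; field; by rewrite !gt_eqF.
- move=> z z0; rewrite l0 ?ltW// addr0 /constant_power z0.
  (* The integrand is the derivative of [pi0 * expR (delta / c * u)], so adding the atom cancels the
     boundary term at 0. *)
  have -> : (\int[mu]_(u in `]0%R, z]) (expR (lambda * u) * (A * expR (- (b * u))))%:E =
      \int[mu]_(u in `]0%R, z]) (pi0%:E * (delta / c * expR (delta / c * u))%:E))%E.
    apply: eq_integral => u _; rewrite -EFinM; congr EFin.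
    rewrite mulrCA -expRD.
    have -> : lambda * u + - (b * u) = delta / c * u by rewrite /b; ring.
    by rewrite /A; ring.
  rewrite ge0_integralZl_EFin//; first last.
  + apply/measurable_EFinP; apply: measurable_funTS; apply: measurable_funM => //.
    by apply: measurableT_comp => //; exact: mulrl_measurable.
  + by move=> u _; rewrite lee_fin mulr_ge0 ?expR_ge0// divr_ge0// ltW.
  rewrite integral_expR_itv// -EFinM; congr EFin.
  have -> : pi0 + pi0 * (expR (delta / c * z) - 1) = pi0 * expR (delta / c * z) by ring.
  have -> : - (b * z) = - (lambda * z) + delta / c * z by rewrite /b; ring.
  by rewrite expRD /A; field; rewrite gt_eqF.
Qed.

Context (f : R -> R) (pi0 : R).
Hypothesis hsd : stationary_distribution delta lambda (constant_power c) l pi0 f.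

(** Obtained from the energy identity, hence valid for every stationary distribution and not only
    for the exponential one exhibited above. *)
Lemma stationary_atom_constant_power : 0 < c -> 1 - pi0 = delta / lambda / c.
Proof.
move=> c0; have := stationary_energy_balance hdelta hlambda hsd.
have -> : (\int[mu]_(z in `]0%R, +oo[) (f z * (constant_power c z + l z))%:E =
    \int[mu]_(z in `]0%R, +oo[) (c%:E * (f z)%:E))%E.
  apply: eq_integral => z; rewrite inE/= in_itv/= andbT => z0.
  by rewrite l0 ?ltW// addr0 /constant_power z0 mulrC.
rewrite integralZl//; last exact: stationary_integrable_density hsd.
rewrite (stationary_integral_density hsd) -EFinM => -[<-].
by rewrite mulrC mulKf// gt_eqF.
Qed.

Lemma expectation_constant_power (phi : R -> R) :
  expectation_pi pi0 f (fun z => phi (constant_power c z)) =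
  ((1 - pi0) * phi c + pi0 * phi 0)%:E.
Proof.
rewrite /expectation_pi {1}/constant_power ltxx.
have -> : (\int[mu]_(z in `]0%R, +oo[) (phi (constant_power c z) * f z)%:E =
    \int[mu]_(z in `]0%R, +oo[) ((phi c)%:E * (f z)%:E))%E.
  apply: eq_integral => z; rewrite inE/= in_itv/= andbT => z0.
  by rewrite /constant_power z0.
rewrite integralZl//; last exact: stationary_integrable_density hsd.
rewrite (stationary_integral_density hsd) -!EFinM -EFinD; congr EFin; ring.
Qed.

End constant_power.

Theorem mainTheorem3 (R : realType)
    (Rs : R -> R) (Dmax : R) (Rth : \bar R) (Rc : R -> R)
    (delta lambda : R) (l : R -> R)
    (hRs : rate_distortion Rs Dmax Rth) (hRc : coding_rate Rc)
    (hdelta : 0 < delta) (hlambda : 0 < lambda) (hl : leakage l) :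
  let Ddag := distortion_dagger Rs Dmax Rth Rc in
  (forall (p : R -> R) (pi0 : R) (f : R -> R) (kappa : R -> R),
     power_policy p ->
     stationary_distribution delta lambda p l pi0 f ->
     mismatch_policy kappa ->
     expectation_pi pi0 f (fun z => (kappa z)^-1) = 1%E ->
     ((Ddag (delta / lambda) 1)%:E <=
      expectation_pi pi0 f (fun z => Ddag (p z) (kappa z)^-1)%R)%E)
  /\
  ((forall z : R, 0 <= z -> l z = 0) ->
   let pstar := fun eps : R => constant_power (delta / lambda + eps) in
   let kstar := fun _ : R => 1 : R in
   let cost := fun (eps pi0 : R) (f : R -> R) =>
     expectation_pi pi0 f (fun z => Ddag (pstar eps z) (kstar z)^-1) in
   (forall eps : R, 0 < eps ->
      [/\ power_policy (pstar eps),
          ergodic delta lambda (pstar eps) l &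
          forall (pi0 : R) (f : R -> R),
            stationary_distribution delta lambda (pstar eps) l pi0 f ->
            1 - pi0 = (delta / lambda) / (delta / lambda + eps) /\
            cost eps pi0 f =
              ((1 - pi0) * Ddag (delta / lambda + eps) 1 + pi0 * Dmax)%:E])
   /\
   (forall (pi0 : R -> R) (f : R -> R -> R),
      (forall eps : R, 0 < eps ->
         stationary_distribution delta lambda (pstar eps) l
           (pi0 eps) (f eps)) ->
      cost eps (pi0 eps) (f eps) @[eps --> 0^'+] -->
        (Ddag (delta / lambda) 1)%:E)).
Proof.
move=> Ddag; split.
  move=> p pi0 f kappa hp hsd hkappa hmean.
  exact: expectation_dagger_ge hRs hRc hdelta hlambda hl hp hsd hkappa hmean.
move=> l0 pstar kstar cost.
have mu0 : 0 < delta / lambda by rewrite divr_gt0.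
have costE (eps pi0 : R) (f : R -> R) : 0 < eps ->
    stationary_distribution delta lambda (pstar eps) l pi0 f ->
    1 - pi0 = (delta / lambda) / (delta / lambda + eps) /\
    cost eps pi0 f =
      ((1 - pi0) * Ddag (delta / lambda + eps) 1 + pi0 * Dmax)%:E.
  move=> eps0 hsd; split.
    by apply: (stationary_atom_constant_power hdelta hlambda l0 hsd); rewrite addr_gt0.
  (* An empty battery gives zero power, whose cost [Ddag 0 1] is [Dmax]. *)
  rewrite /cost /kstar invr1 (expectation_constant_power hsd (Ddag ^~ 1)).
  by rewrite /Ddag (distortion_dagger01 hRs hRc).
split=> [eps eps0|pi0 f hsd].
  split.
  - by apply: power_policy_constant_power; rewrite addr_gt0.
  - by apply: ergodic_constant_power => //; rewrite ltrDl.
  - by move=> pi0 f; exact: costE.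
(* [w e] is the forced value of [1 - pi0 e]; with it the cost becomes an explicit function of [e],
   whatever family of stationary distributions is given. *)
pose w (e : R) := (delta / lambda) / (delta / lambda + e).
apply: (@cvg_trans _ ((w e * Ddag (delta / lambda + e) 1 + (1 - w e) * Dmax)%:E
  @[e --> 0^'+])).
  apply: near_eq_cvg; near=> e; have e0 : 0 < e by [].
  have [wE ->] := costE _ _ _ e0 (hsd _ e0).
  by congr EFin; rewrite /w -wE opprB addrCA subrr addr0.
have wcvg : w e @[e --> 0^'+] --> (1 : R).
  apply: cvg_at_right_filter.
  have -> : 1 = (delta / lambda) / (delta / lambda + 0) :> R.
    by rewrite addr0 divff ?gt_eqF.
  apply: cvgM; first exact: cvg_cst.
  apply: cvgV; first by rewrite addr0 gt_eqF.
  by apply: cvgD; [exact: cvg_cst|exact: cvg_id].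
apply: cvg_EFin; first by near=> e.
(* The limit is recast as [1 * Ddag (delta / lambda) 1 + 0 * Dmax], matching the limits 1 of [w] and
   0 of [1 - w]. *)
rewrite -[X in _ --> X]addr0 -[X in _ --> X + _]mul1r -[X in _ --> _ + X](mul0r Dmax).
apply: cvgD; apply: cvgM => //.
- exact (distortion_dagger_right_cvg hRs hRc mu0).
- have := cvgB (@cvg_cst _ (1 : R) _ (0^'+) _) wcvg; rewrite subrr; exact.
- exact: cvg_cst.
Unshelve. all: by end_near. Qed.
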